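(* Let $G=(V,E)$ be a connected graph and let $\ell: V\to\{-1,+1\}$ be a labeling, unknown to the predictor. Let $A$ be an online routing algorithm on $G$ which, on every request sequence, guarantees that every edge of $G$ is used by at most $\alpha$ of the routed paths. Let $P_A$ be the online prediction algorithm that, on query $v_i$ with $i\ge 2$, feeds $v_i$ to $A$ as the next request, obtains from $A$ a path from $v_i$ to some earlier queried vertex $v_j$ ($j<i$), and predicts the label $\ell(v_j)$. Then, for every query sequence $v_1,v_2,\ldots$, the number of rounds $i\ge 2$ in which $P_A$ predicts incorrectly is at most $\alpha\cdot|cut(\ell)|$, where $cut(\ell)=\{(u,v)\in E:\ell(u)\neq\ell(v)\}$.
   Context: Online prediction of graph labeling: in each round $i=1,2,\ldots$ an adversary asks for the label of a vertex $v_i\in V$; the algorithm outputs a prediction $y_i$ and then learns the true label $\ell(v_i)$. A mistake is a round with $y_i\neq \ell(v_i)$; the mistake on the first query $v_1$ is not counted. Online routing problem: the algorithm receives requests $r_1,r_2,\ldots$ with $r_i\in V$, and for each $r_i$ with $i>1$ must, before seeing later requests, output a path in $G$ routing one unit of flow from $r_i$ to some earlier request $r_j$, $j<i$. The congestion of an edge is the number of output paths using it. *)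

(* Defs.v *)
From HB Require Import structures.
From mathcomp Require Import all_boot all_order all_algebra.
Set Implicit Arguments.
Unset Strict Implicit.
Unset Printing Implicit Defensive.

Record sgraph := SGraph {
  vertex :> finType;
  adj : rel vertex;
  adj_sym : symmetric adj;
  adj_irrefl : irreflexive adj }.

Definition connected_graph (G : sgraph) : Prop :=
  forall x y : G, connect (@adj G) x y.

Definition edges (G : sgraph) : {set {set G}} :=
  [set [set p.1; p.2] | p : G * G & adj p.1 p.2].

(* Labels +1 and -1 are encoded as true and false. *)
Definition label := bool.

Definition cut (G : sgraph) (ell : G -> label) : {set {set G}} :=
  [set [set p.1; p.2] | p : G * G & adj p.1 p.2 && (ell p.1 != ell p.2)].

(* The undirected edges traversed by the path x :: p. *)
Definition path_edges (G : sgraph) (x : G) (p : seq G) : seq {set G} :=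
  pairmap (fun u v : G => [set u; v]) x p.

(* [route h r] is the answer to request r after the earlier requests h (oldest
   first): the routed path is r :: route h r. It is unconstrained when h is
   empty, since the first request is not routed. *)
Record routing_alg (G : sgraph) := RoutingAlg {
  route : seq G -> G -> seq G;
  route_path : forall h r, h != [::] -> path (@adj G) r (route h r);
  route_last : forall h r, h != [::] -> last r (route h r) \in h }.

(* Rounds are indexed from 0; round 0 is neither routed nor counted.
   [mkseq r i] lists the requests preceding r i. Both [congestion] and
   [mistakes] concern the first n rounds of an infinite sequence. *)
Definition congestion (G : sgraph) (A : routing_alg G) (r : nat -> G) (n : nat)
    (f : {set G}) : nat :=
  #|[set i : 'I_n | (0 < i) &&
      (f \in path_edges (r i) (route A (mkseq r i) (r i)))]|.

(* A predictor sees the earlier queries with their revealed labels (oldest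
   first) and the current query. *)
Definition predictor (G : sgraph) := seq (G * label) -> G -> label.

Definition mistakes (G : sgraph) (P : predictor G) (ell : G -> label)
    (v : nat -> G) (n : nat) : nat :=
  #|[set i : 'I_n | (0 < i) &&
      (P (mkseq (fun j => (v j, ell (v j))) i) (v i) != ell (v i))]|.

(* The label is looked up in the history at the end point of the routed path;
   the default false only matters in the first round. *)
Definition routing_predictor (G : sgraph) (A : routing_alg G) : predictor G :=
  fun h x =>
    let u := last x (route A (unzip1 h) x) in
    nth false (unzip2 h) (index u (unzip1 h)).

(* Main.v *)
Require Import Defs.
From HB Require Import structures.
From mathcomp Require Import all_boot all_order all_algebra.
Import Order.TTheory GRing.Theory Num.Theory.
Local Open Scope ring_scope.

(** The predictor is wrong on a query exactly when the routed path joins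
    vertices of different labels, and then the path traverses a cut edge. Hence
    the mistakes are bounded by the total congestion of the cut edges, each of
    which contributes at most [alpha]. *)

Lemma cut_sub_edges (G : sgraph) (ell : G -> label) : cut ell \subset edges G.
Proof.
apply/subsetP => f /imsetP[p]; rewrite inE => /andP[adj_p _] ->.
by apply/imsetP; exists p; rewrite // inE.
Qed.

(** Induction along the path: either its first edge already changes the label, or the label is kept
    and the remaining path still joins different labels. *)
Lemma path_crosses_cut (G : sgraph) (ell : G -> label) (x : G) (p : seq G) :
  path (@adj G) x p -> ell (last x p) != ell x ->
  exists2 f, f \in cut ell & f \in path_edges x p.
Proof.
elim: p x => [|y p IHp] x /=; first by rewrite eqxx.
case/andP=> adj_xy path_p cross.
case: (eqVneq (ell x) (ell y)) => [ell_xy|ell_xy].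
  have [|f f_cut f_p] := IHp y path_p; first by rewrite -ell_xy.
  by exists f => //; rewrite inE f_p orbT.
exists [set x; y]; last exact: mem_head.
by apply/imsetP; exists (x, y); rewrite // inE adj_xy.
Qed.

(** By [route_last] the end point occurs in [s], so the lookup never falls back on its default.
    Repeated queries are harmless: every occurrence of a vertex carries the same label. *)
Lemma routing_predictorE (G : sgraph) (A : routing_alg G) (ell : G -> label)
    (s : seq G) (x : G) : s != [::] ->
  routing_predictor A [seq (u, ell u) | u <- s] x = ell (last x (route A s x)).
Proof.
move=> s_neq0; rewrite /routing_predictor /unzip1 /unzip2 -!map_comp map_id.
have s_last := route_last A x s_neq0.
by rewrite (nth_map x) ?index_mem // nth_index.
Qed.

Lemma leq_card_bigcup (I T : finType) (P : pred I) (F : I -> {set T}) :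
  (#|\bigcup_(i | P i) F i| <= \sum_(i | P i) #|F i|)%N.
Proof.
elim/big_rec2: _ => [|i k B _ le_B_k]; first by rewrite cards0.
by apply: leq_trans (leq_card_setU _ _) _; rewrite leq_add2l.
Qed.

Lemma mistakes_le_cut_congestion (G : sgraph) (ell : G -> label)
    (A : routing_alg G) (v : nat -> G) (n : nat) :
  (mistakes (routing_predictor A) ell v n
     <= \sum_(f in cut ell) congestion A v n f)%N.
Proof.
(* Union bound over cut edges [f], the set for [f] being the rounds whose path uses [f]. *)
apply: leq_trans _ (leq_card_bigcup _ _ _ _).
apply/subset_leq_card/subsetP => i; rewrite inE => /andP[i_gt0].
have s_neq0 : mkseq v i != [::] by rewrite -size_eq0 size_mkseq -lt0n.
(* The labelled history is the image of [mkseq v i] under [u -> (u, ell u)], the shape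
   [routing_predictorE] expects. *)
rewrite [mkseq (fun j => _) i](map_comp (fun u => (u, ell u))).
rewrite routing_predictorE // => mistake.
have [f f_cut f_path] :=
  path_crosses_cut _ _ _ _ (route_path A (v i) s_neq0) mistake.
by apply/bigcupP; exists f; rewrite // inE i_gt0.
Qed.

Theorem theorem1 (G : sgraph) (ell : G -> label) (A : routing_alg G)
    (R : realDomainType) (alpha : R)
    (G_connected : connected_graph G)
    (A_congestion : forall (r : nat -> G) (n : nat) (f : {set G}),
        f \in edges G -> (congestion A r n f)%:R <= alpha)
    (v : nat -> G) (n : nat) :
  (mistakes (routing_predictor A) ell v n)%:R <= alpha * #|cut ell|%:R.
Proof.
apply: (@le_trans _ _ (\sum_(f in cut ell) congestion A v n f)%:R).
  by rewrite ler_nat mistakes_le_cut_congestion.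
(* The bound becomes a sum of [alpha] over the cut, compared edge by edge. *)
rewrite natr_sum mulr_natr -sumr_const; apply: ler_sum => f f_cut.
exact/A_congestion/(subsetP (cut_sub_edges _ ell)).
Qed.
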